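(* For $\alpha\in[0,1]$, \[ \inf_{\mathcal{A} \subseteq \mathbb{N} \colon \mathbf{d}(\mathcal{A}) = \alpha} \mathbf{d}(\mathcal{A}^2)=\begin{cases} 0 & \text{if } \alpha<1,\\ 1 & \text{if } \alpha=1. \end{cases} \]
   Context: $\mathbb{N}=\{1,2,3,\dots\}$. For $\mathcal{A}\subseteq\mathbb{N}$, $\mathcal{A}^2:=\{ab: a,b\in\mathcal{A}\}$. The natural density of $\mathcal{A}$ is $\mathbf{d}(\mathcal{A})=\lim_{x\to\infty}\#(\mathcal{A}\cap[1,x])/x$, when this limit exists. The infimum is taken over all sets $\mathcal{A}\subseteq\mathbb{N}$ whose natural density exists and equals $\alpha$ and for which the natural density of $\mathcal{A}^2$ exists. *)

(* Defs.v *)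
From HB Require Import structures.
From mathcomp Require Import all_boot all_order all_algebra.
From mathcomp Require Import finmap.
From mathcomp Require Import all_classical all_reals all_analysis.
Set Implicit Arguments.
Unset Strict Implicit.
Unset Printing Implicit Defensive.
Import Order.TTheory GRing.Theory Num.Theory.
Import numFieldNormedType.Exports.
Local Open Scope classical_set_scope.
Local Open Scope ring_scope.

Definition posnat : set nat := [set n | (0 < n)%N].

Definition prodset (A : set nat) : set nat :=
  [set (a * b)%N | a in A & b in A].

(** The set under [fset_set] is finite for every real [x], so the cardinal is
    the true one ([fset_set] of an infinite set would be empty). *)
Definition counting_upto (R : realType) (A : set nat) (x : R) : nat :=
  #|` fset_set (A `&` [set n : nat | (1 <= n)%N && (n%:R <= x)])|.

(** [A] has a natural density and it equals [d]. *)
Definition has_density (R : realType) (A : set nat) (d : R) : Prop :=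
  (counting_upto A x)%:R / x @[x --> +oo] --> d.

(** The values [d(A^2)] over the [A] with [d(A) = alpha] for which [d(A^2)]
    exists. *)
Definition square_densities (R : realType) (alpha : R) : set R :=
  [set d | exists A : set nat,
     [/\ A `<=` posnat, has_density A alpha & has_density (prodset A) d]].

(* Main.v *)
(* Upper bound for alpha < 1.  For a finite set of primes s with large
   reciprocal sum M, Turan's inequality concentrates the number Omega s n of
   prime factors of n in s (with multiplicity) near M, so for k ~ 2M/3 the set
   D_k = {Omega s >= k} has density near 1, while D_k^2 = D_{2k} has density
   near 0.  To reach density alpha exactly, take a subset of D_k of density
   alpha and add two null sets Z_true, Z_false with Z_true * Z_false = D_{2k}:
   colour the large primes with two colours, each of divergent reciprocal sum,
   and let Z_c consist of the n in D_k whose large prime factors all have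
   colour c.

   Lower bound for alpha = 1.  Let g(n) = n^-t and let h be multiplicative with
   h(n) = prod_{p | n} (1 - g(p)), so that sum_{d | n} g(d) h(n/d) = 1.  If n is
   not in A^2, every factorization n = d * (n/d) has a factor in the null set
   B = N \ A.  The factorizations with d in B contribute little because
   d |-> g(d) sum_{m <= N/d} h(m) is nonincreasing and has total mass N, and
   those with n/d in B because sum_d g(d)/d converges.  Summation by parts in
   the first case costs a multiple of sum_{m <= N} h(m), which is small: once t
   is so small that g(p) >= 1/2 for the p in s, h(m) <= 2^-(number of primes of
   s dividing m). *)

Require Import Defs.
From mathcomp Require Import all_boot all_order all_algebra.
From mathcomp Require Import finmap.
From mathcomp Require Import all_classical all_reals all_analysis.
From mathcomp Require Import ring lra zify.
Set Implicit Arguments.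
Unset Strict Implicit.
Unset Printing Implicit Defensive.
Import Order.TTheory GRing.Theory Num.Theory.
Import numFieldNormedType.Exports.
Local Open Scope classical_set_scope.
Local Open Scope ring_scope.

(** * Counting functions and densities *)

(** Counting starts at 1, so the value of [P] at 0 never matters. *)
Definition cnt (P : pred nat) (N : nat) : nat := \sum_(1 <= n < N.+1) P n.

(* [C] absorbs the small [N], so that the bound can be asked for all [N]. *)
Definition dens (R : realType) (P : pred nat) (d : R) : Prop :=
  forall e, 0 < e ->
  exists C, forall N, `|(cnt P N)%:R - d * N%:R| <= e * N%:R + C.

(** This forces upper density at most [d], with the bounded error that counts of multiples naturally
    leave. *)
Definition dens_le (R : realType) (P : pred nat) (d : R) : Prop :=
  exists C, forall N, (cnt P N)%:R <= d * N%:R + C.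

Lemma cntE (R : realType) P N :
  (cnt P N)%:R = \sum_(1 <= n < N.+1) (P n)%:R :> R.
Proof. by rewrite /cnt natr_sum. Qed.

Lemma cnt0 P : cnt P 0 = 0%N.
Proof. by rewrite /cnt big_geq. Qed.

Lemma cntS P N : cnt P N.+1 = (cnt P N + P N.+1)%N.
Proof. by rewrite /cnt big_nat_recr. Qed.

Lemma cnt_le P N : (cnt P N <= N)%N.
Proof. by elim: N => [|N IH]; rewrite ?cnt0// cntS; case: (P _); lia. Qed.

Lemma sub_cnt (P Q : pred nat) N :
  (forall n, (0 < n)%N -> P n -> Q n) -> (cnt P N <= cnt Q N)%N.
Proof.
move=> PQ; elim: N => [|N IH]; rewrite ?cnt0// !cntS leq_add//.
by have /implyP := PQ N.+1 isT; case: (P _); case: (Q _).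
Qed.

Lemma eq_cnt (P Q : pred nat) N :
  (forall n, (0 < n)%N -> P n = Q n) -> cnt P N = cnt Q N.
Proof.
by move=> PQ; apply/eqP; rewrite eqn_leq !sub_cnt// => n n0; rewrite PQ.
Qed.

Lemma cntU (P Q : pred nat) N :
  (cnt (predU P Q) N <= cnt P N + cnt Q N)%N.
Proof.
elim: N => [|N IH]; rewrite ?cnt0// !cntS /=.
by case: (P _); case: (Q _) => /=; lia.
Qed.

Lemma cntC (P : pred nat) N : (cnt P N + cnt (predC P) N)%N = N.
Proof.
by elim: N => [|N IH]; rewrite ?cnt0// !cntS /=; case: (P _) => /=; lia.
Qed.

Lemma counting_uptoE (R : realType) (A : set nat) (x : R) : 0 <= x ->
  counting_upto A x = cnt (mem A) (Num.truncn x).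
Proof.
move=> x0; set s := [seq n <- iota 1 (Num.truncn x) | n \in A].
have -> : counting_upto A x = #|` fset_set [set` [fset n in s]%fset]|.
  rewrite /counting_upto; congr (#|` fset_set _|); apply/seteqP; split => n /=.
    move=> [An /andP[n1 nx]].
    rewrite in_fset /= mem_filter mem_iota add1n ltnS n1.
    by rewrite truncn_ge_nat// nx !andbT; exact: mem_set.
  rewrite in_fset /= mem_filter mem_iota add1n ltnS truncn_ge_nat//.
  by case/and3P => /set_mem An n1 nx; split; rewrite ?n1.
rewrite set_fsetK card_fseq undup_id ?filter_uniq ?iota_uniq// size_filter.
rewrite -sum1_count big_mkcond /cnt /index_iota subSS subn0.
by apply: eq_bigr => n _ /=; case: (n \in A).
Qed.

Lemma has_densityP (R : realType) (A : set nat) (d : R) :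
  has_density A d <-> dens (mem A) d.
Proof.
split=> [Ad e e0|Ad].
  have [M [Mr HM]] := (@cvgrPdist_le _ _ _ _ _ _ _).1 Ad e e0.
  (* Beyond [N0] the integer [N] exceeds [M] and the limit applies at [x = N]; the finitely many
     others are absorbed in the constant. *)
  pose N0 := Num.truncn (`|M| + 1).
  exists (N0.+1%:R * (1 + `|d|)) => N.
  have c0 : (0 : R) <= (cnt (mem A) N)%:R by [].
  have cN : (cnt (mem A) N)%:R <= N%:R :> R by rewrite ler_nat cnt_le.
  have [NM|NM] := leqP N N0.
    have NM' : N%:R <= N0.+1%:R :> R by rewrite ler_nat; lia.
    have h1 : `|(cnt (mem A) N)%:R - d * N%:R| <= N%:R * (1 + `|d|).
      apply: le_trans (ler_normB _ _) _.
      rewrite normrM (ger0_norm c0) (ger0_norm (ler0n _ N)); lra.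
    have h2 : N%:R * (1 + `|d|) <= N0.+1%:R * (1 + `|d|).
      by rewrite ler_wpM2r// addr_ge0.
    have : 0 <= e * N%:R by rewrite mulr_ge0// ltW.
    lra.
  have NM' : M < N%:R.
    have : N0.+1%:R <= N%:R :> R by rewrite ler_nat.
    have /andP[_] := truncn_itv (addr_ge0 (normr_ge0 M) ler01).
    rewrite -/N0; have := ler_norm M; lra.
  have N0' : (0 : R) < N%:R by rewrite ltr0n; lia.
  have := HM _ NM'; rewrite counting_uptoE ?ler0n// natrK.
  rewrite distrC => h.
  have -> : (cnt (mem A) N)%:R - d * N%:R =
      ((cnt (mem A) N)%:R / N%:R - d) * N%:R :> R.
    by rewrite mulrBl divfK// gt_eqF.
  rewrite normrM (ger0_norm (ltW N0')).
  have : `|(cnt (mem A) N)%:R / N%:R - d| * N%:R <= e * N%:R.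
    by rewrite ler_wpM2r// ltW.
  have : 0 <= N0.+1%:R * (1 + `|d|) by rewrite mulr_ge0// addr_ge0.
  lra.
apply/cvgrPdist_lt => e e0.
have e20 : 0 < e / 2 by lra.
have [C HC] := Ad _ e20.
have C0 : 0 <= C.
  by have := HC 0%N; rewrite cnt0 !mulr0 subr0 normr0 add0r.
(* Beyond this point [e / 2 * x] exceeds [C] plus the absolute value of [d]; the latter pays for
   replacing [x] by its integer part. *)
exists (1 + (C + `|d|) / (e / 2)); split; first exact: num_real.
move=> x xM.
have x0 : 0 < x.
  by apply: lt_trans xM; rewrite ltr_pwDl// divr_ge0 ?addr_ge0// ltW.
have /andP[tx xt] := truncn_itv (ltW x0).
rewrite counting_uptoE ?ltW//; set N := Num.truncn x in tx xt *.
have -> : d - (cnt (mem A) N)%:R / x = (d * x - (cnt (mem A) N)%:R) / x.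
  by rewrite mulrBl mulfK ?lt0r_neq0.
rewrite normrM normfV (ger0_norm (ltW x0)) ltr_pdivrMr//.
have h1 : d * x - (cnt (mem A) N)%:R =
   - ((cnt (mem A) N)%:R - d * N%:R) + d * (x - N%:R) by ring.
rewrite h1; apply: le_lt_trans (ler_normD _ _) _; rewrite normrN normrM.
have h2 : `|d| * `|x - N%:R| <= `|d| * 1.
  rewrite ler_wpM2l// ger0_norm ?subr_ge0//.
  by rewrite -natr1 in xt; lra.
have h3 : e / 2 * N%:R <= e / 2 * x by rewrite ler_wpM2l// ltW.
have h4 : C + `|d| < e / 2 * x.
  have : (C + `|d|) / (e / 2) < x by lra.
  by rewrite ltr_pdivrMr// mulrC.
have := HC N; lra.
Qed.

Lemma eq_dens (R : realType) (P Q : pred nat) (d : R) :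
  (forall n, (0 < n)%N -> P n = Q n) -> dens P d -> dens Q d.
Proof.
by move=> PQ Pd e /Pd[C HC]; exists C => N; rewrite -(eq_cnt _ PQ).
Qed.

Lemma le_slope (R : realType) (a b C : R) :
  (forall N : nat, a * N%:R <= b * N%:R + C) -> a <= b.
Proof.
move=> h; rewrite leNgt; apply/negP => ba.
have ab0 : 0 < a - b by lra.
pose N := (Num.truncn (`|C| / (a - b))).+1.
have /andP[_ hN] : (Num.truncn (`|C| / (a - b)))%:R <= `|C| / (a - b) < N%:R.
  by apply: truncn_itv; rewrite divr_ge0// ltW.
move: hN; rewrite ltr_pdivrMr// => hN.
have := h N; have := ler_norm C; lra.
Qed.

Lemma dens_le_sub (R : realType) (P Q : pred nat) (d : R) :
  (forall n, (0 < n)%N -> P n -> Q n) -> dens_le Q d -> dens_le P d.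
Proof.
move=> PQ [C HC]; exists C => N; apply: le_trans (HC N).
by rewrite ler_nat sub_cnt.
Qed.

Lemma dens_leU (R : realType) (P Q : pred nat) (a b : R) :
  dens_le P a -> dens_le Q b -> dens_le (predU P Q) (a + b).
Proof.
move=> [C HC] [D HD]; exists (C + D) => N.
have : (cnt (predU P Q) N)%:R <= (cnt P N)%:R + (cnt Q N)%:R :> R.
  by rewrite -natrD ler_nat cntU.
by have := HC N; have := HD N; lra.
Qed.

Lemma dens_dens_le (R : realType) (P : pred nat) (d u : R) :
  dens P d -> dens_le P u -> d <= u.
Proof.
move=> Pd [C HC]; apply/ler_addgt0Pr => e e0.
have [D HD] := Pd _ e0.
apply: (@le_slope _ _ _ (C + D)) => N.
by have := HC N; have := HD N; rewrite ler_norml => /andP[]; lra.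
Qed.

Lemma dens_ge0 (R : realType) (P : pred nat) (d : R) : dens P d -> 0 <= d.
Proof.
move=> Pd; apply/ler_addgt0Pr => e e0.
have [D HD] := Pd _ e0.
apply: (@le_slope _ _ _ D) => N.
have : (0 : R) <= (cnt P N)%:R by [].
by have := HD N; rewrite ler_norml => /andP[]; lra.
Qed.

Lemma densC (R : realType) (P : pred nat) (d : R) :
  dens P d -> dens (predC P) (1 - d).
Proof.
move=> Pd e /Pd[C HC]; exists C => N.
have /(congr1 (fun n => n%:R : R)) := cntC P N; rewrite natrD => h.
have -> : (cnt (predC P) N)%:R - (1 - d) * N%:R =
  - ((cnt P N)%:R - d * N%:R) :> R by rewrite -[X in _ * X]h -h; ring.
by rewrite normrN.
Qed.

(** * Divergence of the reciprocals of the primes *)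

Lemma sum_multiples (R : realType) (d N : nat) (F : nat -> R) : (0 < d)%N ->
  \sum_(1 <= n < N.+1 | (d %| n)%N) F n =
  \sum_(1 <= m < (N %/ d)%N.+1) F (d * m)%N.
Proof.
move=> d0; rewrite big_mkcond; elim: N => [|N IH].
  by rewrite div0n !big_geq.
rewrite big_nat_recr//= IH divnS//.
have [dN|dN] := boolP (d %| N.+1)%N; last by rewrite addr0.
rewrite [in RHS]big_nat_recr//=; congr (_ + F _).
by have := divnS N d0; rewrite dN add1n => <-; rewrite mulnC divnK.
Qed.

Lemma cnt_dvdn (d N : nat) : (0 < d)%N -> cnt (dvdn d) N = (N %/ d)%N.
Proof.
by move=> d0; elim: N => [|N IH]; rewrite ?cnt0 ?div0n// cntS IH divnS// addnC.
Qed.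

(** For primes [s], a partial sum of the expanded Euler product of the factors [(1 - p^-1)^-1]. *)
Definition smooth_sum (R : realType) (s : seq nat) (N : nat) : R :=
  \sum_(1 <= n < N.+1 | all (mem s) (primes n)) n%:R^-1.

Definition recip_sum (R : realType) (s : seq nat) : R := \sum_(p <- s) p%:R^-1.

Lemma recip_sum_ge0 (R : realType) (s : seq nat) : 0 <= recip_sum R s.
Proof. by apply: sumr_ge0 => p _; rewrite invr_ge0. Qed.

Lemma smooth_sum_ge0 (R : realType) (s : seq nat) N : 0 <= smooth_sum R s N.
Proof. by apply: sumr_ge0 => p _; rewrite invr_ge0. Qed.

Lemma smooth_sum_homo (R : realType) (s : seq nat) (M N : nat) :
  (M <= N)%N -> smooth_sum R s M <= smooth_sum R s N.
Proof.
move=> MN; rewrite /smooth_sum [X in _ <= X](@big_cat_nat _ _ _ M.+1)//=.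
by rewrite lerDl; apply: sumr_ge0 => p _; rewrite invr_ge0.
Qed.

(* Splitting off the multiples of [p] gives
   [smooth_sum (p :: s) N <= smooth_sum s N + p^-1 * smooth_sum (p :: s) N]. *)
Lemma smooth_sum_le (R : realType) (s : seq nat) (N : nat) : all prime s ->
  smooth_sum R s N <= expR (2 * recip_sum R s).
Proof.
elim: s => [_|p s IH /= /andP[pp ps]].
  rewrite /recip_sum big_nil mulr0 expR0 /smooth_sum.
  case: N => [|N]; first by rewrite big_geq.
  rewrite big_mkcond big_ltn// big_nat big1 ?addr0 /= ?invr1// => n /andP[n1 _].
  have := pi_pdiv n; rewrite n1 => h.
  by have : pdiv n \in primes n by []; case: (primes n).
have p1 := prime_gt1 pp; have p0 := prime_gt0 pp.
have pR : (2 : R) <= p%:R by rewrite (ler_nat _ 2).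
have split_sum : smooth_sum R (p :: s) N <=
    smooth_sum R s N + p%:R^-1 * smooth_sum R (p :: s) N.
  rewrite {1}/smooth_sum (bigID (dvdn p)) /= addrC; apply: lerD.
    rewrite /smooth_sum big_mkcond [X in _ <= X]big_mkcond.
    rewrite big_nat [X in _ <= X]big_nat /=; apply: ler_sum => n /andP[n0 _].
    case: ifP => [/andP[/allP ha pn]|_].
      rewrite ifT//; apply/allP => q qn; have := ha _ qn; rewrite !inE.
      case/predU1P => // qp; move: qn pn; rewrite qp mem_primes.
      by case/and3P => _ _ ->.
    by case: ifP => //; rewrite invr_ge0.
  rewrite big_andbC big_mkcondr sum_multiples//.
  apply: (@le_trans _ _ (p%:R^-1 * smooth_sum R (p :: s) (N %/ p)%N)).
    rewrite /smooth_sum mulr_sumr [X in _ <= X]big_mkcond /=.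
    rewrite big_nat [X in _ <= X]big_nat /=; apply: ler_sum => n /andP[n0 _].
    case: ifP => [/allP ha|_].
      rewrite ifT ?natrM ?invfM//; apply/allP => q qn; apply: ha.
      by rewrite primesM// qn orbT.
    by case: ifP => // _; rewrite mulr_ge0// invr_ge0.
  by rewrite ler_wpM2l ?invr_ge0// smooth_sum_homo// leq_div.
have {}IH := IH ps.
set T := smooth_sum R (p :: s) N in split_sum *.
set S := smooth_sum R s N in split_sum IH.
rewrite /recip_sum big_cons -/(recip_sum R s) mulrDr expRD.
set q := p%:R^-1 in split_sum *.
have q0 : 0 < q by rewrite invr_gt0; lra.
have q2 : q <= 1 / 2 by rewrite mul1r lef_pV2 ?posrE//; lra.
(* As [q <= 1 / 2], [(1 + 2 * q) * (1 - q) >= 1]; hence the factor 2 in the exponent. *)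
have e1 : 1 <= expR (2 * q) * (1 - q).
  apply: (@le_trans _ _ ((1 + 2 * q) * (1 - q))); first by nra.
  by rewrite ler_wpM2r ?expR_ge1Dx//; lra.
have T0 : 0 <= T by exact: smooth_sum_ge0.
apply: (@le_trans _ _ (expR (2 * q) * S)); last by rewrite ler_wpM2l ?expR_ge0.
apply: (@le_trans _ _ (expR (2 * q) * (1 - q) * T)).
  by rewrite -[X in X <= _]mul1r ler_wpM2r.
by rewrite -mulrA ler_wpM2l ?expR_ge0//; lra.
Qed.

Definition primes_in (y N : nat) := [seq p <- index_iota y.+1 N.+1 | prime p].

Lemma mem_primes_in y N p :
  (p \in primes_in y N) = [&& prime p, (y < p)%N & (p <= N)%N].
Proof. by rewrite mem_filter mem_index_iota ltnS. Qed.

Lemma primes_in_prime y N : all prime (primes_in y N).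
Proof. exact: filter_all. Qed.

Lemma primes_in_uniq y N : uniq (primes_in y N).
Proof. by rewrite filter_uniq// iota_uniq. Qed.

Lemma ln_le_harmonic (R : realType) (N : nat) :
  ln N.+1%:R <= \sum_(1 <= n < N.+1) n%:R^-1 :> R.
Proof.
elim: N => [|N IH]; first by rewrite big_geq// ln1.
rewrite big_nat_recr//=.
have N0 : (0 : R) < N.+1%:R by rewrite ltr0n.
have -> : N.+2%:R = N.+1%:R * (1 + N.+1%:R^-1) :> R.
  by rewrite mulrDr mulfV ?gt_eqF// mulr1 natr1.
have i0 : (0 : R) < N.+1%:R^-1 by rewrite invr_gt0.
rewrite lnM ?posrE//.
by apply: lerD => //; apply: le_ln1Dx; apply: lt_trans i0; rewrite oppr_lt0.
Qed.

(** Euler's argument: every [n <= N] has only prime factors up to [N], so the harmonic sum, at least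
    [ln N.+1%:R], is bounded by [expR] of twice the reciprocal sum. A doubly exponential [N] then
    beats [M] plus the contribution [K] of the primes up to [y]. *)
Lemma recip_primes_unbounded (R : realType) (y : nat) (M : R) :
  exists2 N, (y <= N)%N & M <= recip_sum R (primes_in y N).
Proof.
set K := recip_sum R (primes_in 0 y).
pose N := maxn y (Num.truncn (expR (expR (2 * (M + K))))).
exists N; first exact: leq_maxl.
have N0 : (0 : R) < N.+1%:R by rewrite ltr0n.
have cat_primes : recip_sum R (primes_in 0 N) = K + recip_sum R (primes_in y N).
  rewrite /K /recip_sum /primes_in !big_filter.
  by rewrite (@big_cat_nat _ _ _ y.+1)//= ltnS leq_maxl.
suff : M + K <= recip_sum R (primes_in 0 N) by rewrite cat_primes; lra.
have : expR (expR (2 * (M + K))) <= N.+1%:R.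
  have /andP[_ /ltW h] := truncn_itv (expR_ge0 (expR (2 * (M + K)))).
  by apply: le_trans h _; rewrite ler_nat ltnS leq_maxr.
rewrite -ler_ln ?posrE ?expR_gt0// expRK => h1.
have h2 : \sum_(1 <= n < N.+1) n%:R^-1 <= smooth_sum R (primes_in 0 N) N.
  rewrite /smooth_sum [X in _ <= X]big_mkcond.
  rewrite [X in X <= _]big_nat [X in _ <= X]big_nat /=.
  apply: ler_sum => n /andP[n0 nN].
  rewrite ifT//; apply/allP => p; rewrite mem_primes => /and3P[pp _ pn].
  rewrite inE mem_primes_in pp prime_gt0//=.
  by rewrite -ltnS; apply: leq_ltn_trans nN; apply: dvdn_leq.
have := smooth_sum_le R N (primes_in_prime 0 N).
have := ln_le_harmonic R N => h3 h4.
have : expR (2 * (M + K)) <= expR (2 * recip_sum R (primes_in 0 N)) by lra.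
rewrite ler_expR; lra.
Qed.

(** * Turan's inequality *)

Lemma markov_dens_le (R : realType) (P : pred nat) (f : nat -> R) (a c C : R) :
  0 < c -> (forall n, 0 <= f n) -> (forall n, (0 < n)%N -> P n -> c <= f n) ->
  (forall N, \sum_(1 <= n < N.+1) f n <= a * N%:R + C) ->
  dens_le P (a / c).
Proof.
move=> c0 f0 Pf hf; exists (C / c) => N.
rewrite mulrAC -mulrDl ler_pdivlMr//; apply: le_trans (hf N).
rewrite cntE mulr_suml big_nat [X in _ <= X]big_nat /=.
apply: ler_sum => n /andP[n0 _].
by have := Pf n n0; case: (P n) => [/(_ isT)|_]; rewrite ?mul1r ?mul0r.
Qed.

Lemma divn_le_divr (R : realType) (N d : nat) :
  (N %/ d)%N%:R <= N%:R / d%:R :> R.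
Proof.
case: d => [|d]; first by rewrite divn0 invr0 mulr0.
by rewrite ler_pdivlMr ?ltr0n// -natrM ler_nat leq_trunc_div.
Qed.

Lemma divr_le_divn (R : realType) (N d : nat) :
  N%:R / d%:R <= (N %/ d)%N%:R + 1 :> R.
Proof.
case: d => [|d]; first by rewrite divn0 invr0 mulr0 addr_ge0.
by rewrite ler_pdivrMr ?ltr0n// natr1 -natrM ler_nat ltnW// ltn_ceil.
Qed.

Definition omega (s : seq nat) (n : nat) : nat := count (dvdn^~ n) s.

(** Unlike [omega], this is additive over all products of positive integers, which turns products of
    level sets into level sets; [omega] has the simpler second moment. *)
Definition Omega (s : seq nat) (n : nat) : nat := \sum_(p <- s) logn p n.

Lemma omegaE (R : realType) s n :
  (omega s n)%:R = \sum_(p <- s) (p %| n)%N%:R :> R.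
Proof.
rewrite /omega -sum1_count natr_sum big_mkcond /=.
by apply: eq_bigr => p _; case: (p %| n)%N.
Qed.

Lemma sum_dvdn (R : realType) (d N : nat) : (0 < d)%N ->
  \sum_(1 <= n < N.+1) (d %| n)%N%:R = (N %/ d)%N%:R :> R.
Proof. by move=> d0; rewrite -cnt_dvdn// cntE. Qed.

Lemma sum_omega_ge (R : realType) s N : all prime s ->
  N%:R * recip_sum R s - (size s)%:R <= \sum_(1 <= n < N.+1) (omega s n)%:R.
Proof.
move=> /allP ps; under eq_bigr do rewrite omegaE.
rewrite exchange_big /= /recip_sum mulr_sumr -sum1_size natr_sum -sumrB.
rewrite big_seq [X in _ <= X]big_seq; apply: ler_sum => p /ps pp.
by rewrite sum_dvdn ?prime_gt0// lerBlDr; exact: divr_le_divn.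
Qed.

(** The square is a sum over pairs [p], [q]: distinct primes both divide [n] exactly when [p * q]
    does, and the diagonal gives the extra [recip_sum R s]. *)
Lemma sum_omega_sqr_le (R : realType) s N : uniq s -> all prime s ->
  \sum_(1 <= n < N.+1) (omega s n)%:R ^+ 2 <=
  N%:R * (recip_sum R s ^+ 2 + recip_sum R s).
Proof.
move=> us /allP ps.
have -> : \sum_(1 <= n < N.+1) (omega s n)%:R ^+ 2 =
    \sum_(p <- s) \sum_(q <- s)
      \sum_(1 <= n < N.+1) ((p %| n) && (q %| n))%N%:R :> R.
  under [RHS]eq_bigr do rewrite exchange_big.
  rewrite [RHS]exchange_big; apply: eq_bigr => n _ /=.
  rewrite expr2 omegaE mulr_suml; apply: eq_bigr => p _.
  by rewrite mulr_sumr; apply: eq_bigr => q _; rewrite -natrM mulnb.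
apply: (@le_trans _ _ (\sum_(p <- s) \sum_(q <- s)
    (N%:R * (p%:R^-1 * q%:R^-1) + N%:R * p%:R^-1 * (p == q)%:R))).
  rewrite big_seq [X in _ <= X]big_seq; apply: ler_sum => p /ps pp.
  rewrite big_seq [X in _ <= X]big_seq; apply: ler_sum => q /ps qp.
  have [<-|pq] := eqVneq p q.
    under eq_bigr do rewrite andbb.
    rewrite sum_dvdn ?prime_gt0// mulr1.
    apply: le_trans (divn_le_divr _ _ _) _.
    by rewrite lerDr !mulr_ge0 ?invr_ge0.
  rewrite mulr0 addr0.
  have cpq : coprime p q by rewrite prime_coprime// dvdn_prime2.
  under eq_bigr do rewrite -Gauss_dvd//.
  rewrite sum_dvdn ?muln_gt0 ?prime_gt0//.
  by apply: le_trans (divn_le_divr _ _ _) _; rewrite natrM invfM.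
under eq_bigr do rewrite big_split /= -!mulr_sumr.
rewrite big_split /= -!mulr_sumr -mulr_suml mulrDr lerD//.
rewrite /recip_sum mulr_sumr big_seq [X in _ <= X]big_seq.
apply: ler_sum => p sp; rewrite -[X in _ <= X]mulr1 ler_wpM2l//.
rewrite -natr_sum (_ : (\sum_(q <- s) (p == q) = 1)%N)//.
have := count_uniq_mem p us; rewrite sp /= => <-.
rewrite -sum1_count [RHS]big_mkcond /=; apply: eq_bigr => q _.
by rewrite eq_sym; case: (q == p).
Qed.

(** Once the square is expanded, the terms in [N%:R * M ^+ 2] cancel; the diagonal and the rounding
    error of the first moment remain. *)
Lemma turan (R : realType) s N : uniq s -> all prime s ->
  \sum_(1 <= n < N.+1) ((omega s n)%:R - recip_sum R s) ^+ 2 <=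
  recip_sum R s * N%:R + 2 * recip_sum R s * (size s)%:R.
Proof.
move=> us ps; set M := recip_sum R s.
have M0 : 0 <= M := recip_sum_ge0 R s.
have -> : \sum_(1 <= n < N.+1) ((omega s n)%:R - M) ^+ 2 =
    \sum_(1 <= n < N.+1) (omega s n)%:R ^+ 2
    - 2 * M * \sum_(1 <= n < N.+1) (omega s n)%:R + N%:R * M ^+ 2.
  rewrite mulr_sumr -sumrB.
  have -> : N%:R * M ^+ 2 = \sum_(1 <= n < N.+1) M ^+ 2.
    by rewrite sumr_const_nat subSS subn0 mulr_natl.
  by rewrite -big_split; apply: eq_bigr => n _ /=; ring.
have h1 := sum_omega_sqr_le R N us ps.
have h2 := sum_omega_ge R N ps.
have : 2 * M * (N%:R * M - (size s)%:R) <=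
    2 * M * \sum_(1 <= n < N.+1) (omega s n)%:R.
  by rewrite ler_wpM2l// mulr_ge0.
rewrite -/M in h1 h2 *; lra.
Qed.

(** Chebyshev's inequality, from the second moment in [turan]. *)
Lemma omega_deviation (R : realType) s (P : pred nat) (c : R) :
  uniq s -> all prime s -> 0 < c ->
  (forall n, (0 < n)%N -> P n -> c <= `|(omega s n)%:R - recip_sum R s|) ->
  dens_le P (recip_sum R s / c ^+ 2).
Proof.
move=> us ps c0 Pc.
apply: (@markov_dens_le _ _ (fun n => ((omega s n)%:R - recip_sum R s) ^+ 2)
  _ _ (2 * recip_sum R s * (size s)%:R)).
- by rewrite exprn_gt0.
- by move=> n; exact: sqr_ge0.
- move=> n n0 Pn; rewrite -[X in _ <= X]real_normK ?num_real//.
  rewrite ler_sqr ?nnegrE ?Pc//.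
  exact: ltW.
- by move=> N; exact: turan.
Qed.

Lemma sum_logn_multiples (R : realType) (p N : nat) : prime p ->
  \sum_(1 <= n < N.+1) (logn p n)%:R =
  (N %/ p)%N%:R + \sum_(1 <= n < (N %/ p)%N.+1) (logn p n)%:R :> R.
Proof.
move=> pp; rewrite (bigID (dvdn p)) /= [X in _ + X]big1 ?addr0; last first.
  move=> n pn; rewrite lognE pp; case: n pn => //= n.
  by move/negbTE => ->.
rewrite sum_multiples ?prime_gt0//.
have -> : (N %/ p)%N%:R = \sum_(1 <= n < (N %/ p)%N.+1) 1 :> R.
  by rewrite sumr_const_nat subSS subn0.
rewrite -big_split [LHS]big_nat [RHS]big_nat.
apply: eq_bigr => n /andP[n0 _] /=.
by rewrite (lognM p (prime_gt0 pp) n0) natrD logn_prime// eqxx.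
Qed.

(** Legendre's bound for the exponent of [p] in [N!]: the recursion closes because
    [N / p + N / (p * (p - 1)) = N / (p - 1)]. *)
Lemma sum_logn_le (R : realType) (p N : nat) : prime p ->
  \sum_(1 <= n < N.+1) (logn p n)%:R <= N%:R / p.-1%:R :> R.
Proof.
move=> pp; have [N1] := ubnP N; elim: N1 N => // N1 IH N NN1.
have p1 := prime_gt1 pp.
case: N NN1 => [|N] NN1; first by rewrite big_geq// mul0r.
rewrite sum_logn_multiples//.
apply: le_trans (lerD (divn_le_divr R N.+1 p) (IH _ _)) _.
  by apply: leq_trans (NN1 : N < N1)%N; rewrite ltn_Pdiv.
have pE : p%:R = p.-1%:R + 1 :> R by rewrite natr1 prednK// ltnW.
have q0 : 0 < p.-1%:R :> R by rewrite ltr0n; lia.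
apply: (@le_trans _ _ (N.+1%:R / p%:R + N.+1%:R / p%:R / p.-1%:R)).
  by rewrite lerD2l ler_wpM2r ?invr_ge0// divn_le_divr.
rewrite pE le_eqVlt; apply/orP; left; apply/eqP; field.
by rewrite !gt_eqF//; lra.
Qed.

Lemma omega_le_Omega s n : (0 < n)%N -> all prime s ->
  (omega s n <= Omega s n)%N.
Proof.
move=> n0 /allP ps; rewrite /omega /Omega -sum1_count big_mkcond /=.
rewrite big_seq [X in (_ <= X)%N]big_seq; apply: leq_sum => p /ps pp.
by rewrite lognE pp n0 /=; case: (p %| n)%N.
Qed.

(** For each [p], discarding one factor [p] from every multiple leaves the exponent of [p] in
    [(N %/ p)!], at most [N / (p * (p - 1))]. If the primes in [s] are large, multiplicity thus
    matters little on average. *)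
Lemma sum_Omega_excess (R : realType) s (c : R) N : 0 < c ->
  all prime s -> {in s, forall p, c <= p.-1%:R} ->
  \sum_(1 <= n < N.+1) ((Omega s n)%:R - (omega s n)%:R) <=
  recip_sum R s / c * N%:R.
Proof.
move=> c0 /allP ps sc.
under eq_bigr do rewrite /Omega natr_sum omegaE -sumrB.
rewrite exchange_big /= /recip_sum !mulr_suml big_seq [X in _ <= X]big_seq.
apply: ler_sum => p sp; have pp := ps _ sp.
rewrite sumrB sum_logn_multiples// sum_dvdn ?prime_gt0// addrAC subrr add0r.
apply: le_trans (sum_logn_le _ _ pp) _.
rewrite mulrAC; apply: ler_pM; rewrite ?invr_ge0//.
  by rewrite mulrC divn_le_divr.
by rewrite lef_pV2 ?posrE ?sc//; apply: lt_le_trans (sc _ sp).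
Qed.

(** * The convolution identity *)

(** Complete multiplicativity; the arguments are positive because the weight built later is 1 at 0,
    where the product rule fails. *)
Definition multiplicative_on_pos (R : realType) (g : nat -> R) : Prop :=
  g 1%N = 1 /\ forall m n, (0 < m)%N -> (0 < n)%N -> g (m * n)%N = g m * g n.

(* The Dirichlet inverse of [g], convolved with 1, when [g] is completely
   multiplicative. *)
Definition cofactor_weight (R : realType) (g : nat -> R) (n : nat) : R :=
  \prod_(p <- primes n) (1 - g p).

Lemma sum_divisors (R : realType) (F : nat -> R) (n N : nat) :
  (0 < n)%N -> (n <= N)%N ->
  \sum_(d <- divisors n) F d = \sum_(1 <= d < N.+1 | (d %| n)%N) F d.
Proof.
move=> n0 nN; rewrite -[RHS]big_filter; apply: perm_big.
apply: uniq_perm; rewrite ?filter_uniq ?iota_uniq ?divisors_uniq//.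
move=> d; rewrite -dvdn_divisors// mem_filter mem_index_iota ltnS.
have [dn|//] := boolP (d %| n)%N.
by rewrite (dvdn_gt0 n0 dn) (leq_trans (dvdn_leq n0 dn)).
Qed.

(** Both sides run over the pairs with [d * e <= N], grouped by product or by first entry. *)
Lemma sum_convolution (R : realType) (F : nat -> nat -> R) (N : nat) :
  \sum_(1 <= n < N.+1) \sum_(d <- divisors n) F d (n %/ d)%N =
  \sum_(1 <= d < N.+1) \sum_(1 <= e < (N %/ d)%N.+1) F d e.
Proof.
transitivity (\sum_(1 <= n < N.+1) \sum_(1 <= d < N.+1)
    if (d %| n)%N then F d (n %/ d)%N else 0).
  rewrite [LHS]big_nat [RHS]big_nat; apply: eq_bigr => n /andP[n0 nN].
  by rewrite (@sum_divisors _ _ _ N)// big_mkcond.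
rewrite exchange_big /= [LHS]big_nat [RHS]big_nat.
apply: eq_bigr => d /andP[d0 _]; rewrite -big_mkcond sum_multiples//.
by apply: eq_bigr => e _; rewrite mulKn.
Qed.

Lemma cofactor_weight_prime_power (R : realType) (g : nat -> R) (p v k : nat) :
  prime p -> (0 < v)%N -> (0 < k)%N -> ~~ (p %| k)%N ->
  cofactor_weight g (p ^ v * k) = (1 - g p) * cofactor_weight g k.
Proof.
move=> pp v0 k0 pk; rewrite /cofactor_weight.
have -> : (1 - g p) * \prod_(q <- primes k) (1 - g q) =
    \prod_(q <- p :: primes k) (1 - g q) by rewrite big_cons.
apply: perm_big; apply: uniq_perm; rewrite /= ?primes_uniq//.
  by rewrite mem_primes pp k0 (negbTE pk).
have pv0 : (0 < p ^ v)%N by rewrite expn_gt0 prime_gt0.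
move=> q; rewrite (primesM q pv0 k0) primesX// primes_prime//.
by rewrite !inE.
Qed.

(* The multiples of [p] among the divisors of [n] contribute [g p] times the
   sum for [n %/ p], the others [1 - g p] times the sum for the [p^']-part. *)
Lemma sum_cofactor_weight (R : realType) (g : nat -> R) (n : nat) :
  multiplicative_on_pos g -> (0 < n)%N ->
  \sum_(d <- divisors n) g d * cofactor_weight g (n %/ d)%N = 1.
Proof.
move=> [g1 gM]; have [k] := ubnP n; elim: k n => // k IH n nk n0.
have {}nk : (n <= k)%N by rewrite -ltnS.
have [n1|n1] := leqP n 1.
  have -> : n = 1%N by lia.
  rewrite (_ : divisors 1 = [:: 1%N])// big_seq1 divnn /=.
  by rewrite /cofactor_weight /= big_nil g1 mulr1.
set p := pdiv n; have pp : prime p := pdiv_prime n1.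
have p0 := prime_gt0 pp; have p1 := prime_gt1 pp.
have pn : (p %| n)%N := pdiv_dvd n.
pose n' := (n %/ p)%N; have nE : n = (p * n')%N by rewrite mulnC divnK.
have n'0 : (0 < n')%N by rewrite divn_gt0// dvdn_leq.
pose m := (n`_p^')%N; have m0 : (0 < m)%N := part_gt0 _ _.
have mE : n = (p ^ logn p n * m)%N by rewrite -p_part partnC.
have v0 : (0 < logn p n)%N by rewrite logn_gt0 mem_primes pp n0.
have pm : ~~ (p %| m)%N.
  by rewrite -prime_coprime// (pnat_coprime (pnat_id pp) (part_pnat _ _)).
rewrite (bigID (dvdn p)) /=.
have -> : \sum_(d <- divisors n | (p %| d)%N)
    g d * cofactor_weight g (n %/ d)%N = g p.
  rewrite -big_filter.
  rewrite (perm_big [seq (p * d)%N | d <- divisors n'])/=; last first.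
    apply: uniq_perm.
    - by rewrite filter_uniq ?divisors_uniq.
    - rewrite map_inj_uniq ?divisors_uniq// => a b /eqP.
      by rewrite eqn_pmul2l// => /eqP.
    - move=> d; rewrite mem_filter -dvdn_divisors//.
      apply/andP/mapP => [[/dvdnP[e ->]]|[e]].
        rewrite nE mulnC dvdn_pmul2l// => en'.
        by exists e; rewrite // -dvdn_divisors.
      rewrite -dvdn_divisors// => en' ->; split; first exact: dvdn_mulr.
      by rewrite nE dvdn_pmul2l.
  rewrite big_map -[RHS]mulr1 -(IH n')//; last first.
    by apply: leq_trans nk; rewrite ltn_Pdiv.
  rewrite mulr_sumr big_seq [RHS]big_seq; apply: eq_bigr => d.
  rewrite -dvdn_divisors// => dn'; have d0 := dvdn_gt0 n'0 dn'.
  by rewrite gM// mulrA nE divnMl.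
have -> : \sum_(d <- divisors n | ~~ (p %| d)%N)
    g d * cofactor_weight g (n %/ d)%N = 1 - g p.
  rewrite -big_filter (perm_big (divisors m))/=; last first.
    apply: uniq_perm; rewrite ?filter_uniq ?divisors_uniq// => d.
    rewrite mem_filter -!dvdn_divisors// mE.
    have [pd|pd] := boolP (p %| d)%N => /=.
      by apply/esym/negbTE; apply: contra pm; apply: dvdn_trans.
    by rewrite Gauss_dvdr// coprimeXr// coprime_sym prime_coprime.
  rewrite -[RHS]mulr1 -[X in _ = _ * X](IH m)//; last first.
    apply: leq_trans nk; rewrite [X in (_ < X)%N]mE.
    by rewrite ltn_Pmull// -(expn0 p) ltn_exp2l.
  rewrite mulr_sumr big_seq [RHS]big_seq; apply: eq_bigr => d.
  rewrite -dvdn_divisors// => dm; have d0 := dvdn_gt0 m0 dm.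
  (* Here [n %/ d] is the full power of [p] in [n] times [m %/ d], so its weight has exactly one
     factor [1 - g p]. *)
  rewrite [X in (X %/ _)%N]mE -muln_divA// cofactor_weight_prime_power//.
  - by rewrite mulrCA.
  - by rewrite divn_gt0// dvdn_leq.
  - by apply: contra pm => /dvdn_trans; apply; apply: dvdn_div.
by rewrite addrC subrK.
Qed.

(** * Partial summation and the weight [n^-t] *)

Lemma sum_nonincreasing_le (R : realType) (f : nat -> R) (B : pred nat)
    (e C : R) (N : nat) :
  (forall n, 0 <= f n) -> (forall n, (0 < n)%N -> f n.+1 <= f n) ->
  (forall n, (cnt B n)%:R <= e * n%:R + C) ->
  \sum_(1 <= n < N.+1) f n * (B n)%:R <=
  e * \sum_(1 <= n < N.+1) f n + C * f 1%N.
Proof.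
move=> f0 fS hB.
have C0 : 0 <= C by have := hB 0%N; rewrite cnt0 mulr0 add0r.
case: N => [|N]; first by rewrite !big_geq// mulr0 add0r mulr_ge0.
(* The induction is Abel summation: it retains the boundary term, and its step uses that the
   decrease of [f] times the slack in [hB] is nonnegative. *)
suff : f N.+1 * (e * N.+1%:R + C - (cnt B N.+1)%:R) <=
    e * \sum_(1 <= n < N.+2) f n + C * f 1%N
    - \sum_(1 <= n < N.+2) f n * (B n)%:R.
  have : 0 <= f N.+1 * (e * N.+1%:R + C - (cnt B N.+1)%:R).
    by rewrite mulr_ge0// subr_ge0.
  lra.
elim: N => [|N IH].
  rewrite !big_nat1 cntS cnt0 add0n; lra.
rewrite !(big_nat_recr N.+2)//= cntS natrD -[N.+2%:R]natr1.
have : 0 <= (f N.+1 - f N.+2) * (e * N.+1%:R + C - (cnt B N.+1)%:R).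
  by rewrite mulr_ge0// subr_ge0// fS.
lra.
Qed.

(** The weight is [n^-t]: a small [t] keeps it at least 1/2 up to [y], while any [t > 0] makes
    [g n / n] summable and the mean of [g] vanish. *)
Lemma decay_weight (R : realType) (y : nat) :
  exists g : nat -> R,
  [/\ multiplicative_on_pos g,
      forall n, 0 < g n <= 1,
      forall n, (0 < n)%N -> g n.+1 <= g n,
      forall n, (n <= y)%N -> 1 / 2 <= g n &
      (exists Z, forall N, \sum_(1 <= n < N.+1) g n / n%:R <= Z) /\
      forall e, 0 < e ->
        exists K, forall N, \sum_(1 <= n < N.+1) g n <= e * N%:R + K].
Proof.
pose t : R := (2 * y.+1%:R)^-1.
have y0 : (0 : R) < y.+1%:R by rewrite ltr0n.
have t0 : 0 < t by rewrite invr_gt0 mulr_gt0.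
have ty : t * y.+1%:R = 1 / 2.
  by rewrite /t invfM -mulrA mulVf ?gt_eqF// mulr1 div1r.
clearbody t.
pose g n : R := expR (- (t * ln n%:R)).
have ln_nat n : 0 <= ln n%:R :> R.
  by case: n => [|n]; [rewrite ln0 | rewrite ln_ge0// (ler_nat _ 1)].
have g01 n : 0 < g n <= 1.
  by rewrite expR_gt0 -expR0 ler_expR lerNl oppr0 mulr_ge0// ltW.
exists g; split=> //.
- split=> [|m n m0 n0]; first by rewrite /g ln1 mulr0 oppr0 expR0.
  rewrite /g -expRD natrM lnM ?posrE ?ltr0n//; congr expR; ring.
- move=> n n0; rewrite ler_expR lerN2 ler_wpM2l ?(ltW t0)//.
  by rewrite ler_ln ?posrE ?ltr0n// ler_nat.
- move=> n ny; apply: le_trans (expR_ge1Dx _).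
  suff : t * ln n%:R <= 1 / 2 by lra.
  case: n ny => [_|n ny]; first by rewrite ln0// mulr0; lra.
  have l1 : ln n.+1%:R <= y.+1%:R :> R.
    have n0 : (0 : R) <= n%:R by [].
    have : ln (1 + n%:R) <= n%:R :> R by apply: le_ln1Dx; lra.
    rewrite addrC natr1 => h; apply: le_trans h _; rewrite ler_nat; lia.
  apply: (@le_trans _ _ (t * y.+1%:R)); first by rewrite ler_wpM2l// ltW.
  by rewrite ty.
- split; last first.
  (* Solving [n^-t = e] gives [n = e^(-1/t)]; the fewer than [K0] earlier terms are at most 1
     each. *)
  move=> e e0; pose K0 := (Num.truncn (expR (- ln e / t))).+1.
  have small n : (K0 <= n)%N -> g n <= e.
    move=> Kn; rewrite -[X in _ <= X]lnK ?posrE// ler_expR.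
    have /andP[_ h] := truncn_itv (expR_ge0 (- ln e / t)).
    have : expR (- ln e / t) < n%:R.
      by apply: lt_le_trans h _; rewrite ler_nat.
    rewrite -ltr_ln ?posrE ?expR_gt0//; last first.
      by rewrite ltr0n; apply: leq_trans Kn.
    rewrite expRK ltr_pdivrMr// => {}h; rewrite mulrC; lra.
  exists K0%:R => N.
  suff : \sum_(1 <= n < N.+1) g n <= e * N%:R + (minn N K0)%:R.
    have : (minn N K0)%:R <= K0%:R :> R by rewrite ler_nat geq_minr.
    lra.
  elim: N => [|N IH]; first by rewrite big_geq// mulr0 add0r.
  have /andP[_ gN] := g01 N.+1.
  have [NK|NK] := leqP K0 N.+1.
    have -> : e * N.+1%:R = e * N%:R + e by rewrite -natr1; ring.
    have := small _ NK; rewrite big_nat_recr//=.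
    have : (minn N K0)%:R <= K0%:R :> R by rewrite ler_nat geq_minr.
    lra.
  have NE : minn N K0 = N by apply/minn_idPl; lia.
  rewrite NE in IH; rewrite big_nat_recr//= -natr1; lra.
  exists (1 + t^-1).
  have ti : 0 < t^-1 by rewrite invr_gt0.
  case=> [|N]; first by rewrite big_geq// addr_ge0// ltW.
  (* Comparison with the integral of [x^(-1-t)], whose tail beyond [N.+1] is [g N.+1 / t]. *)
  suff : \sum_(1 <= n < N.+2) g n / n%:R <= 1 + t^-1 - g N.+1 / t.
    have /andP[gN _] := g01 N.+1.
    have : 0 <= g N.+1 / t by rewrite mulr_ge0// ltW.
    lra.
  elim: N => [|N IH].
    by rewrite big_nat1 divr1 /g ln1 mulr0 oppr0 expR0 div1r addrK.
  rewrite big_nat_recr//=.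
  suff : g N.+2 / N.+2%:R <= g N.+1 / t - g N.+2 / t.
    move: IH; rewrite -!/(g _).
    move: (g N.+1 / t) (g N.+2 / t) (g N.+2 / N.+2%:R) => *; lra.
  set a : R := N.+1%:R in IH *.
  have a0 : 0 < a by rewrite ltr0n.
  have b0 : (0 : R) < N.+2%:R by rewrite ltr0n.
  have aE : a = N.+2%:R * (1 - N.+2%:R^-1).
    by rewrite mulrBr mulr1 mulfV ?gt_eqF// /a -[N.+2%:R]natr1 addrK.
  have i1 : 0 < 1 - (N.+2%:R)^-1 :> R.
    by rewrite subr_gt0 invf_lt1// (ltr_nat _ 1).
  (* With [b = N.+2], [ln (1 - 1/b) <= - 1/b], which the exponential turns into
     [g (b - 1) >= g b * (1 + t / b)]. *)
  have hln : ln a - ln N.+2%:R <= - (N.+2%:R)^-1.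
    rewrite aE lnM ?posrE// addrAC subrr add0r.
    by apply: le_ln1Dx; rewrite ltrN2 invf_lt1// (ltr_nat _ 1).
  have gE : g N.+1 = g N.+2 * expR (t * (ln N.+2%:R - ln a)).
    rewrite /g -expRD -/a; congr expR; ring.
  have /andP[g2 _] := g01 N.+2.
  have : g N.+2 * (1 + t / N.+2%:R) <= g N.+1.
    rewrite gE ler_wpM2l ?(ltW g2)//; apply: le_trans (expR_ge1Dx _).
    by rewrite lerD2l ler_wpM2l ?(ltW t0)// -lerN2 opprB.
  rewrite -mulrBl ler_pdivlMr// mulrDr mulr1 -lerBrDl mulrCA => h.
  by rewrite mulrC.
Qed.

(** * The mean of the cofactor weight *)

Lemma count_mem_primes s n : uniq s -> all prime s -> (0 < n)%N ->
  count (mem s) (primes n) = omega s n.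
Proof.
move=> us /allP ps n0; rewrite /omega -!size_filter; apply: perm_size.
apply: uniq_perm; rewrite ?filter_uniq ?primes_uniq// => p.
rewrite !mem_filter mem_primes n0 /= andbC.
have [sp|] := boolP (p \in s); last by rewrite !andbF.
by rewrite (ps _ sp).
Qed.

Lemma cofactor_weight_ge0 (R : realType) (g : nat -> R) n :
  (forall n, 0 < g n <= 1) -> 0 <= cofactor_weight g n.
Proof.
by move=> g01; apply: prodr_ge0 => p _; rewrite subr_ge0; case/andP: (g01 p).
Qed.

Lemma cofactor_weight_le (R : realType) (g : nat -> R) s n :
  uniq s -> all prime s -> (forall n, 0 < g n <= 1) ->
  {in s, forall p, 1 / 2 <= g p} -> (0 < n)%N ->
  cofactor_weight g n <= (1 / 2) ^+ omega s n.
Proof.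
move=> us ps g01 gs n0; rewrite -count_mem_primes// /cofactor_weight.
elim: (primes n) => [|p r IH]; first by rewrite big_nil.
rewrite big_cons /= exprD; have /andP[g0 g1] := g01 p.
apply: ler_pM => //; first by rewrite subr_ge0.
  by apply: prodr_ge0 => q _; rewrite subr_ge0; case/andP: (g01 q).
have [sp|sp] := boolP (p \in s); last by rewrite expr0; lra.
by have := gs _ sp; rewrite expr1; lra.
Qed.

Lemma omega_lt_small (R : realType) (j : nat) (e : R) : 0 < e ->
  exists s, [/\ uniq s, all prime s & dens_le (fun n => (omega s n < j)%N) e].
Proof.
(* The term [2 * j] makes [omega s n < j] a deviation of at least [M / 2]; the term [4 / e] makes
   the resulting bound [4 / M] at most [e]. *)
move=> e0; pose M0 : R := 2 * j%:R + 4 / e + 1.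
have e4 : 0 < 4 / e by rewrite divr_gt0.
have j0 : (0 : R) <= j%:R by [].
have [N _ MN] := recip_primes_unbounded 0 M0; set s := primes_in 0 N in MN.
have us : uniq s := primes_in_uniq _ _.
have ps : all prime s := primes_in_prime _ _.
exists s; split=> //; set M := recip_sum R s in MN.
have M2 : 0 < M / 2 by rewrite /M0 in MN; lra.
have [C HC] : dens_le (fun n => (omega s n < j)%N) (M / (M / 2) ^+ 2).
  apply: omega_deviation => // n n0 nj; rewrite -/M distrC.
  apply: le_trans (ler_norm _).
  have : (omega s n)%:R <= j%:R :> R by rewrite ler_nat ltnW.
  by rewrite /M0 in MN; lra.
exists C => N'; apply: le_trans (HC N') _; rewrite lerD2r ler_wpM2r//.
have -> : M / (M / 2) ^+ 2 = 4 / M by field; rewrite gt_eqF//; lra.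
rewrite ler_pdivrMr; last by lra.
rewrite mulrC -ler_pdivrMr//; rewrite /M0 in MN; lra.
Qed.

(** [s] and [C] come before [g], because the decay of [g] will be chosen in terms of [s]. Integers
    with fewer than [j] prime factors in [s] are rare, and the others have weight at most [2^-j]. *)
Lemma sum_cofactor_weight_small (R : realType) (e : R) : 0 < e ->
  exists s, [/\ uniq s, all prime s &
    exists C, forall g : nat -> R, (forall n, 0 < g n <= 1) ->
      {in s, forall p, 1 / 2 <= g p} ->
      forall N, \sum_(1 <= n < N.+1) cofactor_weight g n <= e * N%:R + C].
Proof.
move=> e0; have e2 : 0 < e / 2 by lra.
pose j := (Num.truncn (2 / e)).+1.
have je : (1 / 2) ^+ j <= e / 2.
  have /andP[_ h] := truncn_itv (divr_ge0 (ler0n R 2) (ltW e0)).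
  have h2 : 2 / e <= 2 ^+ j.
    apply/ltW/(lt_trans h).
    by rewrite -natrX ltr_nat ltn_expl.
  rewrite expr_div_n expr1n div1r -[X in _ <= X]invrK lef_pV2 ?posrE.
  - by rewrite invf_div.
  - by rewrite exprn_gt0.
  - by rewrite invr_gt0.
have [s [us ps [C HC]]] := omega_lt_small j e2.
exists s; split=> //; exists C => g g01 gs N.
apply: (@le_trans _ _ (\sum_(1 <= n < N.+1) (e / 2 + (omega s n < j)%N%:R))).
  rewrite big_nat [X in _ <= X]big_nat; apply: ler_sum => n /andP[n0 _].
  apply: le_trans (cofactor_weight_le us ps g01 gs n0) _.
  have [nj|nj] := ltnP (omega s n) j.
    have : (1 / 2 : R) ^+ omega s n <= 1 by rewrite exprn_ile1//; lra.
    by rewrite /=; lra.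
  rewrite addr0; apply: le_trans je.
  by apply: ler_wiXn2l => //; lra.
rewrite big_split /= sumr_const_nat subSS subn0 -cntE -mulr_natr.
have := HC N; lra.
Qed.

(** * Products of a set of density 1 *)

Lemma dens0_le (R : realType) (P : pred nat) (e : R) :
  dens P (0 : R) -> 0 < e -> dens_le P e.
Proof.
move=> P0 e0; have [C HC] := P0 _ e0; exists C => N.
by have := HC N; rewrite mul0r subr0 ler_norml => /andP[].
Qed.

Lemma dens_le_const_ge0 (R : realType) (P : pred nat) (e C : R) :
  (forall N, (cnt P N)%:R <= e * N%:R + C) -> 0 <= C.
Proof. by move=> /(_ 0%N); rewrite cnt0 mulr0 add0r. Qed.

(* If [n] is not a product of two elements of [A], then in every
   factorization [n = d * (n / d)] one of the factors is outside [A]; average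
   this over the probability weights [g d * cofactor_weight g (n / d)]. *)
Lemma products_dens1 (R : realType) (A Q : pred nat) :
  (forall a b, (0 < a)%N -> (0 < b)%N -> A a -> A b -> Q (a * b)%N) ->
  dens A (1 : R) -> forall e : R, 0 < e -> dens_le (predC Q) e.
Proof.
move=> AQ A1 e e0; pose B := predC A.
have B0 : dens B (0 : R) by have := densC A1; rewrite subrr.
have e4 : 0 < e / 4 by lra.
(* The choices depend on one another in this order: [C1], then [s] and [CH], then [g] and [Z], then
   [C2], then [K]. Adding 1 to [C1], [Z] and [C2] keeps the denominators positive. *)
have [C1 HC1] := dens0_le B0 e4.
have C10 := dens_le_const_ge0 HC1.
have eH : 0 < e / 4 / (C1 + 1) by rewrite divr_gt0//; lra.
have [s [us ps [CH HH]]] := sum_cofactor_weight_small eH.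
have [g [gM g01 gdecr ghalf [[Z HZ] gsum]]] := decay_weight R (\max_(p <- s) p).
have {}ghalf : {in s, forall p, 1 / 2 <= g p}.
  by move=> p sp; apply: ghalf; exact: leq_bigmax_seq.
have {}HH := HH g g01 ghalf.
have g0 n : 0 <= g n by case/andP: (g01 n) => /ltW.
pose h := cofactor_weight g.
have h0 n : 0 <= h n by exact: cofactor_weight_ge0.
pose H N := \sum_(1 <= n < N.+1) h n.
have Hhomo M N : (M <= N)%N -> H M <= H N.
  move=> MN; rewrite /H [X in _ <= X](@big_cat_nat _ _ _ M.+1)//=.
  by rewrite lerDl sumr_ge0.
have H0 N : 0 <= H N by apply: sumr_ge0.
have h1 n : (0 < n)%N -> h n <= 1.
  move=> n0; have := cofactor_weight_le us ps g01 ghalf n0.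
  move=> /le_trans; apply; apply: exprn_ile1; lra.
have Z0 : 0 <= Z by have := HZ 0%N; rewrite big_geq.
have e2 : 0 < e / 4 / (Z + 1) by rewrite divr_gt0//; lra.
have [C2 HC2] := dens0_le B0 e2.
have C20 := dens_le_const_ge0 HC2.
have e3 : 0 < e / 4 / (C2 + 1) by rewrite divr_gt0//; lra.
have [K HK] := gsum _ e3.
exists (C1 * CH + C2 * K) => N.
have total : \sum_(1 <= d < N.+1) g d * H (N %/ d)%N = N%:R.
  transitivity (\sum_(1 <= n < N.+1) \sum_(d <- divisors n)
      g d * h (n %/ d)%N).
    rewrite (sum_convolution (fun d e => g d * h e)).
    by apply: eq_bigr => d _; rewrite mulr_sumr.
  rewrite big_nat (eq_bigr (fun=> 1)); last first.
    by move=> n /andP[n0 _]; exact: sum_cofactor_weight.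
  by rewrite -big_nat sumr_const_nat subSS subn0.
have first_factor : \sum_(1 <= d < N.+1) g d * H (N %/ d)%N * (B d)%:R <=
    e / 4 * N%:R + C1 * H N.
  have := @sum_nonincreasing_le _ (fun d => g d * H (N %/ d)%N) B _ _ N _ _ HC1.
  rewrite total divn1 gM.1 mul1r; apply.
    by move=> n; rewrite mulr_ge0.
  move=> n n0; apply: ler_pM => //; first exact: gdecr.
  by apply: Hhomo; apply: leq_div2l.
(* Since [h <= 1], the inner sum is at most [g d] times the number of elements of [B] up to [N / d];
   [HZ] and [HK] then bound the sums of [g d / d] and of [g d]. *)
have second_factor : \sum_(1 <= d < N.+1)
    \sum_(1 <= m < (N %/ d)%N.+1) g d * h m * (B m)%:R <=
    e / 4 / (Z + 1) * Z * N%:R + C2 * (e / 4 / (C2 + 1) * N%:R + K).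
  apply: (@le_trans _ _ (\sum_(1 <= d < N.+1)
      (e / 4 / (Z + 1) * N%:R * (g d / d%:R) + C2 * g d))).
    apply: ler_sum => d _.
    apply: (@le_trans _ _ (g d * (cnt B (N %/ d))%:R)).
      rewrite cntE mulr_sumr big_nat [X in _ <= X]big_nat.
      apply: ler_sum => m /andP[m0 _].
      by rewrite -mulrA ler_wpM2l// ler_piMl// h1.
    apply: (@le_trans _ _ (g d * (e / 4 / (Z + 1) * (N%:R / d%:R) + C2))).
      rewrite ler_wpM2l//; apply: le_trans (HC2 _) _.
      by rewrite lerD2r ler_wpM2l ?(ltW e2)// divn_le_divr.
    rewrite le_eqVlt; apply/orP; left; apply/eqP; ring.
  rewrite big_split /= -!mulr_sumr; apply: lerD.
    rewrite [X in _ <= X]mulrAC ler_wpM2l//.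
    by rewrite mulr_ge0// ltW.
  by rewrite ler_wpM2l.
have count_bound : (cnt (predC Q) N)%:R <=
    \sum_(1 <= d < N.+1) g d * H (N %/ d)%N * (B d)%:R +
    \sum_(1 <= d < N.+1)
      \sum_(1 <= m < (N %/ d)%N.+1) g d * h m * (B m)%:R.
  have -> : \sum_(1 <= d < N.+1) g d * H (N %/ d)%N * (B d)%:R =
      \sum_(1 <= d < N.+1)
        \sum_(1 <= m < (N %/ d)%N.+1) g d * h m * (B d)%:R.
    apply: eq_bigr => d _; rewrite mulr_sumr mulr_suml.
    by apply: eq_bigr => m _.
  rewrite -big_split /=; under [X in _ <= X]eq_bigr do rewrite -big_split /=.
  rewrite -(sum_convolution
    (fun d m => g d * h m * (B d)%:R + g d * h m * (B m)%:R)).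
  rewrite cntE big_nat [X in _ <= X]big_nat; apply: ler_sum => n /andP[n0 _].
  have gh0 d m : 0 <= g d * h m by rewrite mulr_ge0.
  rewrite /=; case: (boolP (Q n)) => [_|Qn].
    by apply: sumr_ge0 => d _; rewrite addr_ge0// mulr_ge0.
  apply: (@le_trans _ _ (\sum_(d <- divisors n) g d * h (n %/ d)%N)).
    by rewrite sum_cofactor_weight.
  rewrite big_seq [X in _ <= X]big_seq.
  apply: ler_sum => d; rewrite -dvdn_divisors// => dn.
  rewrite -mulrDr -[X in X <= _]mulr1 ler_wpM2l ?gh0//.
  have d0 := dvdn_gt0 n0 dn.
  have nd0 : (0 < n %/ d)%N by rewrite divn_gt0// dvdn_leq.
  rewrite -natrD (ler_nat _ 1) /B /=.
  case: (boolP (A d)) => Ad //; case: (boolP (A (n %/ d)%N)) => And //.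
  by have := AQ _ _ d0 nd0 Ad And; rewrite mulnC divnK// (negbTE Qn).
have HN : C1 * H N <= C1 * (e / 4 / (C1 + 1) * N%:R + CH).
  by rewrite ler_wpM2l//; exact: HH.
have frac (x : R) : 0 <= x -> e / 4 / (x + 1) * x * N%:R <= e / 4 * N%:R.
  move=> x0; rewrite ler_wpM2r// mulrAC ler_pdivrMr; last by lra.
  by rewrite ler_wpM2l ?(ltW e4)//; lra.
have := frac _ C10; have := frac _ C20; have := frac _ Z0.
have : 0 <= e * N%:R by rewrite mulr_ge0// ltW.
move=> h01 f1 f2 f3.
have E1 : C1 * (e / 4 / (C1 + 1) * N%:R + CH) =
    e / 4 / (C1 + 1) * C1 * N%:R + C1 * CH by ring.
have E2 : C2 * (e / 4 / (C2 + 1) * N%:R + K) =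
    e / 4 / (C2 + 1) * C2 * N%:R + C2 * K by ring.
rewrite E1 in HN; rewrite E2 in second_factor.
(* One quarter each comes from [first_factor] directly, from [C1 * H N], and from the [Z] and [C2]
   terms of [second_factor]. *)
have E4 : e * N%:R = e / 4 * N%:R + e / 4 * N%:R + e / 4 * N%:R + e / 4 * N%:R.
  by field.
rewrite E4; move: f1 f2 f3 HN count_bound first_factor second_factor.
set x1 := e / 4 / (C1 + 1) * C1 * N%:R.
set x2 := e / 4 / (C2 + 1) * C2 * N%:R.
set x3 := e / 4 / (Z + 1) * Z * N%:R.
set x4 := e / 4 * N%:R.
clearbody x1 x2 x3 x4; lra.
Qed.

(** * Sets with prescribed densities *)

(** Whole periods match the density exactly, so the error comes from the last incomplete period and
    is at most [W]. *)
Lemma dens_periodic (R : realType) (P : pred nat) (W : nat) : (0 < W)%N ->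
  (forall n, (0 < n)%N -> P (n + W)%N = P n) ->
  dens P ((cnt P W)%:R / W%:R : R).
Proof.
move=> W0 PW e e0; set d := _ / _.
have cntW N : cnt P (N + W) = (cnt P N + cnt P W)%N.
  elim: N => [|N IH]; first by rewrite cnt0.
  by rewrite addSn !cntS IH -addSn PW// addnAC.
have cntqW q r : cnt P (q * W + r) = (q * cnt P W + cnt P r)%N.
  elim: q => [|q IH]; first by rewrite !mul0n.
  by rewrite !mulSn -addnA addnC cntW IH addnC addnA.
have W0R : (0 : R) < W%:R by rewrite ltr0n.
have d0 : 0 <= d by rewrite divr_ge0.
have d1 : d <= 1 by rewrite ler_pdivrMr// mul1r ler_nat cnt_le.
exists W%:R => N; apply: (@le_trans _ _ W%:R); last first.
  by rewrite lerDr mulr_ge0// ltW.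
rewrite (divn_eq N W) cntqW; set q := (N %/ W)%N; set r := (N %% W)%N.
have dW : d * W%:R = (cnt P W)%:R by rewrite divfK ?gt_eqF.
have -> : (q * cnt P W + cnt P r)%N%:R - d * (q * W + r)%N%:R =
    (cnt P r)%:R - d * r%:R.
  rewrite !natrD !natrM -dW; ring.
have rW : r%:R <= W%:R :> R by rewrite ler_nat ltnW// ltn_mod.
have cr : (cnt P r)%:R <= r%:R :> R by rewrite ler_nat cnt_le.
have c0 : (0 : R) <= (cnt P r)%:R by [].
have r0 : (0 : R) <= r%:R by [].
have dr : d * r%:R <= r%:R by rewrite ler_piMl.
have dr0 : 0 <= d * r%:R by rewrite mulr_ge0.
by rewrite ler_norml; apply/andP; split; lra.
Qed.

(** If the cap is active at one [p], that term alone is already at least [j] on both sides. *)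
Lemma leq_sum_minn (s : seq nat) (a w : nat -> nat) (j : nat) :
  {in s, forall p, (j <= w p)%N} ->
  (j <= \sum_(p <- s) minn (a p) (w p))%N = (j <= \sum_(p <- s) a p)%N.
Proof.
move=> jw.
have [/hasP[p sp ap]|/hasPn h] := boolP (has (fun p => w p < a p)%N s).
  have jwp := jw _ sp; rewrite !(big_rem p sp) /=.
  rewrite !(leq_trans _ (leq_addr _ _))// ?leq_min ?jwp ?andbT//;
    by rewrite (leq_trans jwp)// ltnW.
congr (_ <= _)%N; rewrite big_seq [RHS]big_seq; apply: eq_bigr => p sp.
by apply/minn_idPl; rewrite leqNgt h.
Qed.

(** Capping the exponents at those of [W] amounts to taking [gcdn n W], so the condition is periodic
    with period [W]. *)
Lemma Omega_ge_dens (R : realType) (s : seq nat) (j : nat) : all prime s ->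
  exists d : R, dens (fun n => (j <= Omega s n)%N) d.
Proof.
move=> /allP ps; pose W := ((\prod_(p <- s) p) ^ j)%N.
have prod0 : (0 < \prod_(p <- s) p)%N.
  by rewrite big_seq prodn_cond_gt0// => p /ps /prime_gt0.
have W0 : (0 < W)%N by rewrite expn_gt0 prod0.
have jW : {in s, forall p, (j <= logn p W)%N}.
  move=> p sp; rewrite /W lognX leq_pmulr// logn_gt0 mem_primes ps// prod0.
  by rewrite (big_rem p sp) /= dvdn_mulr.
have OW n : (0 < n)%N -> (j <= Omega s n)%N = (j <= Omega s (gcdn n W))%N.
  move=> n0; rewrite -(leq_sum_minn (logn^~ n) jW); congr (_ <= _)%N.
  by apply: eq_bigr => p _; rewrite logn_gcd.
eexists; apply: (dens_periodic W0) => n n0.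
by rewrite OW ?addn_gt0 ?n0// gcdnC gcdnDr gcdnC -OW.
Qed.

(* The [i]-th element of [D] is kept when [trunc (b * i)] jumps, for
   [b = alpha / d]. *)
Lemma dens_subset (R : realType) (D : pred nat) (d alpha : R) :
  dens D d -> 0 < d -> 0 <= alpha <= d ->
  exists2 X : pred nat, forall n, X n -> D n & dens X alpha.
Proof.
move=> Dd d0 /andP[a0 ad]; pose b := alpha / d.
have b0 : 0 <= b by rewrite divr_ge0// ltW.
have b1 : b <= 1 by rewrite ler_pdivrMr// mul1r.
pose T n := Num.truncn (b * (cnt D n)%:R).
have bc0 n : 0 <= b * (cnt D n)%:R by rewrite mulr_ge0.
exists (fun n => D n && (T n.-1 < T n)%N); first by move=> n /andP[].
(* [T] grows only on [D], and by at most 1 since [b <= 1], so the number of jumps telescopes to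
   [T N]. *)
have cntX N : cnt (fun n => D n && (T n.-1 < T n)%N) N = T N.
  elim: N => [|N IH]; first by rewrite /T !cnt0 mulr0 truncn0.
  rewrite cntS IH /=; have [DN|DN] := boolP (D N.+1); last first.
    by rewrite /T cntS (negbTE DN) !addn0.
  have T1 : (T N <= T N.+1)%N.
    by apply: le_truncn; rewrite ler_wpM2l// ler_nat cntS leq_addr.
  have T2 : (T N.+1 <= (T N).+1)%N.
    rewrite -ltnS /T truncn_lt_nat// cntS DN natrD mulrDr mulr1 -natr1.
    have /andP[_ h] := truncn_itv (bc0 N); rewrite -/(T N) in h *; lra.
  by rewrite /=; case: ltnP => h /=; lia.
move=> e e0; have [C HC] := Dd _ e0; exists (C + 1) => N; rewrite cntX.
have aE : alpha = b * d by rewrite divfK ?gt_eqF.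
have -> : (T N)%:R - alpha * N%:R = b * ((cnt D N)%:R - d * N%:R)
    - (b * (cnt D N)%:R - (T N)%:R) by rewrite aE; ring.
apply: le_trans (ler_normB _ _) _; rewrite addrA; apply: lerD.
  rewrite normrM (ger0_norm b0); apply: le_trans (HC N).
  by rewrite ler_piMl.
have /andP[h1 h2] := truncn_itv (bc0 N); rewrite -/(T N) in h1 h2.
rewrite ger0_norm ?subr_ge0//; rewrite -natr1 in h2; lra.
Qed.

Lemma dens_add_null (R : realType) (P X Z : pred nat) (d : R) :
  (forall n, (0 < n)%N -> P n = X n || Z n) -> dens X d ->
  (forall e : R, 0 < e -> dens_le Z e) -> dens P d.
Proof.
move=> PXZ Xd Z0 e e0; have e2 : 0 < e / 2 by lra.
have [C HC] := Xd _ e2; have [D HD] := Z0 _ e2.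
exists (C + D) => N.
have h1 : (cnt X N)%:R <= (cnt P N)%:R :> R.
  by rewrite ler_nat sub_cnt// => n n0 Xn; rewrite PXZ// Xn.
have h2 : (cnt P N)%:R <= (cnt X N)%:R + (cnt Z N)%:R :> R.
  rewrite -natrD ler_nat; apply: leq_trans (cntU _ _ _).
  by rewrite sub_cnt// => n n0; rewrite PXZ.
have := HC N; have := HD N; rewrite !ler_norml => hD /andP[hC1 hC2].
have e2N : 0 <= e / 2 * N%:R by rewrite mulr_ge0// ltW.
have D0 := dens_le_const_ge0 HD.
by apply/andP; split; lra.
Qed.

(* Consecutive blocks of primes with reciprocal sums tending to infinity get
   alternating colours. *)
Lemma prime_colouring (R : realType) :
  exists col : nat -> bool, forall (b : bool) (y : nat) (M : R),
  exists s, [/\ uniq s, all prime s,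
    {in s, forall p, (y < p)%N /\ col p = b} & M <= recip_sum R s].
Proof.
have block_end i :
    exists N, (i < N)%N /\ i.+1%:R <= recip_sum R (primes_in i N).
  have [N iN sN] := recip_primes_unbounded i (i.+1%:R : R).
  (* Equality would leave an empty block, with reciprocal sum 0. *)
  exists N; split=> //; rewrite ltn_neqAle iN andbT; apply/eqP => iE.
  move: sN; rewrite -iE /primes_in /index_iota subnn /recip_sum big_nil.
  by rewrite lern0.
have [f Hf] := choice block_end.
pose B i := iter i f 0%N.
have BS i : (B i < B i.+1)%N by exact: (Hf _).1.
have Bhomo : {homo B : i j / (i <= j)%N}.
  by apply: homo_leq => // [|i]; [exact: leq_trans | exact: ltnW].
have Bge i : (i <= B i)%N.
  by elim: i => // i IH; apply: leq_ltn_trans IH (BS i).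
pose inblock i p := (B i < p <= B i.+1)%N.
have inblock_inj i j p : inblock i p -> inblock j p -> i = j.
  move=> /andP[i1 i2] /andP[j1 j2]; case: (ltngtP i j) => // /Bhomo h.
    by have := leq_trans i2 h; rewrite leqNgt j1.
  by have := leq_trans j2 h; rewrite leqNgt i1.
exists (fun p => `[< exists2 i, odd i & inblock i p >]) => b y M.
(* The block index has parity [b], is at least [y], so that the primes of the block exceed [y], and
   is at least [t], so that their reciprocal sum reaches [M]. *)
set t := Num.truncn `|M|; pose i := (b + (y + t).*2)%N.
have yi : (y <= i)%N by rewrite /i -addnn; lia.
have ti : (t <= i)%N by rewrite /i -addnn; lia.
exists (primes_in (B i) (B i.+1)); split.
- exact: primes_in_uniq.
- exact: primes_in_prime.
- move=> p; rewrite mem_primes_in => /andP[_ ip]; split.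
    have /andP[Bp _] := ip; apply: leq_ltn_trans Bp; exact: leq_trans (Bge i).
  have oi : odd i = b by rewrite /i oddD odd_double addbF oddb.
  apply/asboolP/idP => [[j oj /inblock_inj jE]|bt].
    by rewrite -oi -(jE i).
  by exists i; rewrite ?oi.
- apply: le_trans (ler_norm M) _; apply: le_trans (Hf (B i)).2.
  have /andP[_ /ltW h] := truncn_itv (normr_ge0 M); apply: le_trans h _.
  by rewrite ler_nat ltnS; apply: leq_trans (Bge i).
Qed.

(** Primes up to [y] are left free; with [y] at least every prime in [s], those counted by [Omega s]
    are not constrained. *)
Definition monochromatic (col : nat -> bool) (y : nat) (c : bool) : pred nat :=
  fun n => all (fun p => (y < p)%N ==> (col p == c)) (primes n).

(** No prime of [s] divides such an [n], having the opposite colour; thus [omega s n = 0] misses the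
    mean by the full [recip_sum R s], and Chebyshev's bound is its inverse. *)
Lemma monochromatic_null (R : realType) (col : nat -> bool) (y : nat)
    (c : bool) :
  (forall M : R, exists s, [/\ uniq s, all prime s,
    {in s, forall p, (y < p)%N /\ col p = ~~ c} & M <= recip_sum R s]) ->
  forall e : R, 0 < e -> dens_le (monochromatic col y c) e.
Proof.
move=> hcol e e0; have [s [us ps sc sM]] := hcol e^-1.
have ei : 0 < e^-1 by rewrite invr_gt0.
have M0 : 0 < recip_sum R s by exact: lt_le_trans sM.
have [C HC] : dens_le (monochromatic col y c)
    (recip_sum R s / recip_sum R s ^+ 2).
  apply: omega_deviation => // n n0 /allP nc.
  rewrite (_ : omega s n = 0%N) ?sub0r ?normrN ?ger0_norm// ?ltW//.
  apply/eqP; rewrite -leqn0 leqNgt -has_count; apply/hasPn => p sp.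
  apply/negP => pn; have [yp cp] := sc _ sp.
  have := nc p; rewrite mem_primes n0 pn (allP ps)// yp cp => /(_ isT).
  by case: (c).
exists C => N; apply: le_trans (HC N) _; rewrite lerD2r ler_wpM2r//.
rewrite expr2 invfM mulrA mulfV ?gt_eqF// mul1r.
by rewrite -[e]invrK lef_pV2 ?posrE.
Qed.

(** * Factorizations with prescribed colours *)

Lemma OmegaM s m n : (0 < m)%N -> (0 < n)%N ->
  Omega s (m * n) = (Omega s m + Omega s n)%N.
Proof.
move=> m0 n0; rewrite /Omega -big_split /=.
by apply: eq_bigr => p _; rewrite lognM.
Qed.

(** Greedy: as long as [Omega s u < Omega s n], some prime of [s] divides [n %/ u] and can be moved
    into [u]. *)
Lemma Omega_divisor s n k : uniq s -> all prime s -> (0 < n)%N ->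
  (k <= Omega s n)%N ->
  exists u, [/\ (u %| n)%N, {subset primes u <= s} & Omega s u = k].
Proof.
move=> us /allP ps n0; elim: k => [_|k IH kn].
  exists 1%N; split; rewrite ?dvd1n// /Omega big1// => p _.
  by rewrite logn1.
have [u [un su uk]] := IH (ltnW kn).
have u0 := dvdn_gt0 n0 un.
pose v := (n %/ u)%N; have nE : n = (u * v)%N by rewrite mulnC divnK.
have v0 : (0 < v)%N by rewrite divn_gt0// dvdn_leq.
have : (0 < Omega s v)%N by move: kn; rewrite nE OmegaM// uk; lia.
rewrite lt0n /Omega sum_nat_seq_neq0 => /hasP[p sp].
rewrite /= -lt0n logn_gt0 mem_primes => /and3P[pp _ pv].
have p0 := prime_gt0 pp.
exists (u * p)%N; split.
- by rewrite nE dvdn_pmul2l.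
- move=> q; rewrite (primesM q u0 p0) (primes_prime pp) mem_seq1.
  by case/orP => [/su//|/eqP->].
- rewrite -/(Omega s _) OmegaM// uk /Omega.
  suff -> : (\sum_(q <- s) logn q p = 1)%N.
    by rewrite addn1.
  have := count_uniq_mem p us; rewrite sp /= => <-.
  rewrite -sum1_count [RHS]big_mkcond /= big_seq [RHS]big_seq.
  by apply: eq_bigr => q sq; rewrite logn_prime ?ps//; case: (q == p).
Qed.

(** The first factor takes a divisor made of exactly [k] primes of [s], with multiplicity, and all
    large primes of colour [true]; the rest goes into the second, including the at least [k]
    remaining primes of [s]. *)
Lemma Omega_split s col y k n : uniq s -> all prime s ->
  {in s, forall p, (p <= y)%N} -> (0 < n)%N -> (k + k <= Omega s n)%N ->
  exists a b, [/\ n = (a * b)%N, (0 < a)%N, (0 < b)%N,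
    (k <= Omega s a)%N && monochromatic col y true a &
    (k <= Omega s b)%N && monochromatic col y false b].
Proof.
move=> us ps sy n0 kn.
have [u [un su uk]] := Omega_divisor us ps n0 (leq_trans (leq_addr k k) kn).
have u0 := dvdn_gt0 n0 un.
pose m := (n %/ u)%N; have nE : n = (u * m)%N by rewrite mulnC divnK.
have m0 : (0 < m)%N by rewrite divn_gt0// dvdn_leq.
pose pi : nat_pred := [pred p | (y < p)%N && col p].
have mE := partnC pi m0.
exists (u * m`_pi)%N, (m`_pi^')%N.
have a0 : (0 < u * m`_pi)%N by rewrite muln_gt0 u0 part_gt0.
split; rewrite ?part_gt0//; first by rewrite -mulnA mE.
- rewrite OmegaM ?part_gt0// uk leq_addr /=; apply/allP => p.
  rewrite (primesM p u0 (part_gt0 _ _)) => /orP[/su/sy py|].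
    by rewrite ltnNge py.
  rewrite primes_part mem_filter => /andP[/andP[yp cp] _].
  by rewrite yp cp.
- apply/andP; split; last first.
    apply/allP => p; rewrite primes_part mem_filter => /andP[pc _].
    by apply/implyP => yp; move: pc; rewrite !inE yp /= => /negbTE ->.
  have small : Omega s m`_pi = 0%N.
    rewrite /Omega big_seq big1// => p sp; apply/eqP.
    rewrite -leqn0 leqNgt logn_gt0 primes_part mem_filter negb_and.
    by rewrite inE /= ltnNge sy.
  move: kn; rewrite nE OmegaM// uk leq_add2l -[X in (_ <= Omega s X)%N -> _]mE.
  by rewrite OmegaM ?part_gt0// small.
Qed.

(** * Upper bound for [alpha < 1] *)

Lemma Omega_concentration (R : realType) (e : R) : 0 < e ->
  exists s k, [/\ uniq s, all prime s, (0 < k)%N,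
    dens_le (fun n => (Omega s n < k)%N) e &
    dens_le (fun n => (k + k <= Omega s n)%N) e].
Proof.
move=> e0; have e12 : 0 < 12 / e by rewrite divr_gt0.
have e72 : 0 < 72 / e by rewrite divr_gt0.
pose c : R := (Num.truncn (12 / e)).+1%:R.
have ce : 12 / e < c.
  by have /andP[] := truncn_itv (ltW e12).
(* The primes taken satisfy [p.-1 >= c > 12 / e], and [M >= 72 / e]: the errors [6 / c] and [36 / M]
   below are then each at most [e / 2]. *)
have [N _ sM] := recip_primes_unbounded (Num.truncn (12 / e)).+2 (6 + 72 / e).
set s := primes_in _ N in sM; set M := recip_sum R s in sM.
have us : uniq s := primes_in_uniq _ _.
have ps : all prime s := primes_in_prime _ _.
have M6 : 6 < M by lra.
have eM : 36 / M <= e / 2.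
  rewrite ler_pdivrMr; last by lra.
  have : 72 / e <= M by lra.
  by rewrite ler_pdivrMr//; lra.
have ec : 6 / c <= e / 2.
  rewrite ler_pdivrMr; last by lra.
  by move: (ltW ce); rewrite ler_pdivrMr//; lra.
have devM : M / (M / 6) ^+ 2 = 36 / M by field; rewrite gt_eqF//; lra.
have k0 : 0 <= 2 / 3 * M by lra.
have /andP[k1 k2] := truncn_itv k0.
exists s, (Num.truncn (2 / 3 * M)).+1; split=> //.
  have [C HC] : dens_le
      (fun n => (Omega s n < (Num.truncn (2 / 3 * M)).+1)%N) (36 / M).
    rewrite -devM; apply: omega_deviation => //; first by lra.
    move=> n n0 nk; rewrite -/M distrC; apply: le_trans (ler_norm _).
    have : (omega s n)%:R <= (Num.truncn (2 / 3 * M))%:R :> R.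
      by rewrite ler_nat; apply: leq_trans (omega_le_Omega n0 ps) _.
    lra.
  exists C => N'; apply: le_trans (HC N') _; rewrite lerD2r ler_wpM2r//; lra.
set k := (Num.truncn (2 / 3 * M)).+1 in k2 *.
(* As [4 / 3 = 7 / 6 + 1 / 6], having [Omega s n >= k + k > 4 / 3 * M] forces a large [omega] ([h1])
   or a large excess ([h2]). *)
have h1 : dens_le (fun n => 7 / 6 * M <= (omega s n)%:R) (36 / M).
  rewrite -devM; apply: omega_deviation => //; first by lra.
  move=> n n0 nk; rewrite -/M; apply: le_trans (ler_norm _); lra.
have h2 : dens_le (fun n => M / 6 <= (Omega s n)%:R - (omega s n)%:R :> R)
    (M / c / (M / 6)).
  apply: (@markov_dens_le _ _
    (fun n => `|(Omega s n)%:R - (omega s n)%:R|) _ _ 0) => //.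
  - by lra.
  - by move=> n n0 h; apply: le_trans h (ler_norm _).
  move=> N'; rewrite addr0.
  rewrite big_nat (eq_bigr (fun n => (Omega s n)%:R - (omega s n)%:R)).
    rewrite -big_nat; apply: sum_Omega_excess => //.
    move=> p; rewrite mem_primes_in => /and3P[_ yp _].
    by rewrite /c ler_nat; lia.
  move=> n /andP[n0 _]; rewrite ger0_norm// subr_ge0 ler_nat.
  exact: omega_le_Omega.
have [//|C' HC'] := @dens_le_sub _
  (fun n => (k + k <= Omega s n)%N) _ _ _ (dens_leU h1 h2).
  move=> n n0 kn /=.
  have h : k%:R + k%:R <= (Omega s n)%:R :> R by rewrite -natrD ler_nat.
  by case: leP => //= h'; lra.
exists C' => N'; apply: le_trans (HC' N') _; rewrite lerD2r ler_wpM2r//.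
have -> : M / c / (M / 6) = 6 / c by field; rewrite !gt_eqF//; lra.
apply: le_trans (lerD eM ec) _; lra.
Qed.

Lemma small_square_density (R : realType) (alpha e : R) :
  0 <= alpha < 1 -> 0 < e ->
  exists2 d, square_densities alpha d & d <= e.
Proof.
(* The second bound forces [d1 >= (1 + alpha) / 2 > alpha], leaving room for a subset of density
   [alpha]. *)
move=> /andP[a0 a1] e0; pose e' := Num.min e ((1 - alpha) / 2).
have e'0 : 0 < e' by rewrite lt_min e0 divr_gt0//; lra.
have e'e : e' <= e by rewrite ge_min lexx.
have e'a : e' <= (1 - alpha) / 2 by rewrite ge_min lexx orbT.
have [s [k [us ps k0 low high]]] := Omega_concentration e'0.
have [d1 Hd1] := Omega_ge_dens R k ps.
have [d2 Hd2] := Omega_ge_dens R (k + k) ps.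
have d1a : alpha < d1.
  have : 1 - d1 <= e'.
    apply: (dens_dens_le (densC Hd1)); apply: dens_le_sub low.
    by move=> n _ /=; rewrite ltnNge.
  lra.
have d10 : 0 < d1 by lra.
have [X XD Xa] : exists2 X : pred nat,
    forall n, X n -> (k <= Omega s n)%N & dens X alpha.
  by apply: dens_subset Hd1 d10 _; rewrite a0 ltW.
have [col Hcol] := prime_colouring R.
pose y := \max_(p <- s) p.
pose Z c n := (k <= Omega s n)%N && monochromatic col y c n.
pose S n := [|| X n, Z true n | Z false n].
have SD n : S n -> (k <= Omega s n)%N.
  by case/or3P => [/XD|/andP[]|/andP[]].
pose A : set nat := [set n | (0 < n)%N && S n].
have mA n : (n \in A) = (0 < n)%N && S n by apply: asboolb.
exists d2; last first.
  apply: le_trans (dens_dens_le Hd2 _) e'e; exact: high.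
exists A; split; first by move=> n /andP[].
- apply/has_densityP.
  apply: (@dens_add_null _ _ X (predU (Z true) (Z false))) => //.
    by move=> n n0; rewrite /= mA n0.
  move=> r r0; have r2 : 0 < r / 2 by lra.
  have Zr c : dens_le (Z c) (r / 2).
    apply: dens_le_sub (monochromatic_null (Hcol (~~ c) y) r2).
    by move=> n _ /andP[].
  by rewrite (_ : r = r / 2 + r / 2); [exact: dens_leU | field].
(* The two null sets alone produce every [n] with [Omega s n >= k + k], and [SD] keeps all products
   in this set, whatever [X] is. *)
- apply/has_densityP; apply: eq_dens Hd2 => n n0; apply/idP/idP.
    move=> kn; have sy : {in s, forall p, (p <= y)%N}.
      by move=> p sp; exact: leq_bigmax_seq.
    have [a [b [-> a0' b0' Za Zb]]] := Omega_split col us ps sy n0 kn.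
    apply/mem_set; exists a; first by apply/andP; rewrite /S /Z Za orbT.
    by exists b => //; apply/andP; rewrite /S /Z Zb !orbT.
  move/set_mem => [a /andP[a0' /SD ka] [b /andP[b0' /SD kb] <-]].
  by rewrite OmegaM// leq_add.
Qed.

(* The infimum is taken in the extended reals, where inf of the empty set is
   +oo, so the equality also asserts that the infimum is over a nonempty set. *)
Theorem theorem1p2 (R : realType) (alpha : R) (halpha : 0 <= alpha <= 1) :
  ereal_inf (EFin @` square_densities alpha) =
  (if alpha < 1 then 0 else 1)%:E.
Proof.
have /andP[a0 a1] := halpha.
apply/eqP; rewrite eq_le; apply/andP; split.
  have [alt1|age1] := ltP alpha 1.
    apply/lee_addgt0Pr => e e0; rewrite add0e.
    have [||d Sd de] := @small_square_density _ alpha e => //.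
      by rewrite a0.
    apply: ge_ereal_inf; exists d%:E; last by rewrite lee_fin.
    by exists d.
  (* For [alpha = 1] the set of all positive integers, equal to its own square, attains 1. *)
  apply: ge_ereal_inf; exists 1%:E => //; exists 1 => //.
  have -> : alpha = 1 by apply/eqP; rewrite eq_le a1.
  have dens1 (P : pred nat) : (forall n, (0 < n)%N -> P n) -> dens P (1 : R).
    move=> P1 e e0; exists 0 => N.
    rewrite (_ : cnt P N = N).
      by rewrite mul1r subrr normr0 addr0 mulr_ge0// ltW.
    by elim: N => [|N IH]; rewrite ?cnt0// cntS IH P1// addn1.
  exists posnat; split=> //; apply/has_densityP; apply: dens1 => n n0 /=.
    exact/mem_set.
  apply/mem_set; exists 1%N => //; exists n => //; exact: mul1n.
apply/ereal_infP => _ [d [A [Apos /has_densityP Aa /has_densityP A2d]] <-].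
rewrite lee_fin; case: ltP => [_|age1]; first exact: dens_ge0 A2d.
have aE : alpha = 1 by apply/eqP; rewrite eq_le a1.
rewrite aE in Aa; apply/ler_addgt0Pr => e e0.
have : 1 - d <= e.
  apply: dens_dens_le (densC A2d) _; apply: products_dens1 Aa _ e0.
  move=> a b _ _ /set_mem Ama /set_mem Amb; apply/mem_set.
  by exists a => //; exists b.
lra.
Qed.
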